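(* Let $A=(a_{ij})$ be a real $n\times n$ matrix, let $B$ and $C$ be the $n\times n$ matrices with entries $B_{ij}=\max(a_{ij},0)$ and $C_{ij}=\max(-a_{ij},0)$ (so $A=B-C$), and let $S=\begin{pmatrix} B & C\\ C & B\end{pmatrix}$. Let $b_i=(\underline{b}_i,\overline{b}_i)$, $1\le i\le n$, be fuzzy numbers, and write $\underline{b}=(\underline{b}_1,\dots,\underline{b}_n)^T$, $\overline{b}=(\overline{b}_1,\dots,\overline{b}_n)^T$. Suppose that $S$ is nonsingular. Then the $2n\times 2n$ crisp linear system $$S\,(\underline{x}_1,\dots,\underline{x}_n,-\overline{x}_1,\dots,-\overline{x}_n)^T=(\underline{b}_1,\dots,\underline{b}_n,-\overline{b}_1,\dots,-\overline{b}_n)^T$$ has a strong solution if and only if $$(B+C)^{-1}(\underline{b}-\overline{b})\le 0 .$$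
   Context: A fuzzy number (in parametric form) is a pair $u=(\underline{u},\overline{u})$ of functions $\underline{u},\overline{u}:[0,1]\to\mathbb{R}$ such that $\underline{u}$ is bounded, monotonically increasing and left continuous, $\overline{u}$ is bounded, monotonically decreasing and left continuous, and $\underline{u}(r)\le\overline{u}(r)$ for all $r\in[0,1]$. Monotonicity is meant in the weak sense (a crisp real number $a$ is the fuzzy number with $\underline{u}(r)=\overline{u}(r)=a$ for all $r$). The unknowns $\underline{x}_i,\overline{x}_i$ of the crisp system are real-valued functions of $r\in[0,1]$, and the system is required to hold for every $r\in[0,1]$. A solution $(\underline{x}_1,\dots,\underline{x}_n,-\overline{x}_1,\dots,-\overline{x}_n)^T$ of the crisp system is called a strong solution if $\underline{x}_i\le\overline{x}_i$ (i.e. $\underline{x}_i(r)\le\overline{x}_i(r)$ for all $r\in[0,1]$) for each $1\le i\le n$. Vector inequalities are entrywise and, for vectors of functions of $r$, are required for every $r\in[0,1]$. When $S$ is nonsingular, $B+C$ is nonsingular, so $(B+C)^{-1}$ is defined. *)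

(* Defs.v *)
From HB Require Import structures.
From mathcomp Require Import all_boot all_order all_algebra.
From mathcomp Require Import all_classical all_reals all_analysis.

Set Implicit Arguments.
Unset Strict Implicit.
Unset Printing Implicit Defensive.

Import Order.TTheory GRing.Theory Num.Theory.
Import numFieldNormedType.Exports.

Local Open Scope classical_set_scope.
Local Open Scope ring_scope.

(* A function on [0, 1] is encoded as a function R -> R of which only the     *)
(* restriction to [0, 1] matters: every condition below is relativized to     *)
(* `[0, 1].  Left continuity is required on `]0, 1], since it is vacuous at 0 *)
(* for a function defined on [0, 1] only.                                     *)
Record fuzzy_number (R : realType) := FuzzyNumber {
  fuzzy_lower : R -> R;
  fuzzy_upper : R -> R;
  fuzzy_lower_bounded : [bounded fuzzy_lower r | r in `[0, 1]];
  fuzzy_lower_increasing :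
    {in `[0, 1] &, {homo fuzzy_lower : r s / r <= s}};
  fuzzy_lower_left_continuous :
    {in `]0, 1], forall r, fuzzy_lower s @[s --> r^'-] --> fuzzy_lower r};
  fuzzy_upper_bounded : [bounded fuzzy_upper r | r in `[0, 1]];
  fuzzy_upper_decreasing :
    {in `[0, 1] &, {homo fuzzy_upper : r s /~ r <= s}};
  fuzzy_upper_left_continuous :
    {in `]0, 1], forall r, fuzzy_upper s @[s --> r^'-] --> fuzzy_upper r};
  fuzzy_lower_le_upper :
    {in `[0, 1], forall r, fuzzy_lower r <= fuzzy_upper r} }.

Definition pos_mx (R : realType) (n : nat) (A : 'M[R]_n) : 'M[R]_n :=
  \matrix_(i, j) Num.max (A i j) 0.

Definition neg_mx (R : realType) (n : nat) (A : 'M[R]_n) : 'M[R]_n :=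
  \matrix_(i, j) Num.max (- A i j) 0.

Definition crisp_mx (R : realType) (n : nat) (A : 'M[R]_n) : 'M[R]_(n + n) :=
  block_mx (pos_mx A) (neg_mx A) (neg_mx A) (pos_mx A).

Definition lower_vec (R : realType) (n : nat) (b : 'I_n -> fuzzy_number R)
  (r : R) : 'cV[R]_n := \col_i fuzzy_lower (b i) r.

Definition upper_vec (R : realType) (n : nat) (b : 'I_n -> fuzzy_number R)
  (r : R) : 'cV[R]_n := \col_i fuzzy_upper (b i) r.

(* The unknowns xl, xu are arbitrary real functions of r: they are not        *)
(* required to form fuzzy numbers.                                            *)
Definition crisp_solution (R : realType) (n : nat) (A : 'M[R]_n)
    (b : 'I_n -> fuzzy_number R) (xl xu : 'I_n -> R -> R) : Prop :=
  {in `[0, 1], forall r,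
    crisp_mx A *m col_mx (\col_i xl i r) (- \col_i xu i r) =
    col_mx (lower_vec b r) (- upper_vec b r)}.

Definition strong_solution (R : realType) (n : nat) (A : 'M[R]_n)
    (b : 'I_n -> fuzzy_number R) (xl xu : 'I_n -> R -> R) : Prop :=
  crisp_solution A b xl xu /\
  forall i, {in `[0, 1], forall r, xl i r <= xu i r}.

(* Main.v *)
Require Import Defs.
From HB Require Import structures.
From mathcomp Require Import all_boot all_order all_algebra.
From mathcomp Require Import all_classical all_reals all_analysis.

Import Order.TTheory GRing.Theory Num.Theory.
Import numFieldNormedType.Exports.

Local Open Scope classical_set_scope.
Local Open Scope ring_scope.

(* Adding the two block rows of the crisp system gives                        *)
(* (B + C) (xl - xu) = bl - bu, so the sign of xl - xu in the unique solution *)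
(* is the sign of (B + C)^-1 (bl - bu).                                       *)

(** Invertibility of [S] gives a solution at each r separately, so only its sign is at stake.
    [unitmx_add_block_sym] makes [B + C] invertible, and [block_sym_sub] then fixes the difference
    of the two halves. *)

Lemma unitmx_add_block_sym (R : comUnitRingType) (n : nat) (P N : 'M[R]_n) :
  block_mx P N N P \in unitmx -> P + N \in unitmx.
Proof.
(* The columns of [J] span the vectors (v, v), a subspace on which the block matrix acts as [P + N].
   The upper half of its inverse applied to [J] is thus a left inverse of [P + N]. *)
move=> S_unit; set J : 'M[R]_(n + n, n) := col_mx 1%:M 1%:M.
have SJ : block_mx P N N P *m J = J *m (P + N).
  by rewrite mul_block_col mul_col_mx !mulmx1 mul1mx [N + P]addrC.
have: usubmx (invmx (block_mx P N N P) *m J) *m (P + N) = 1%:M.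
  by rewrite mul_usub_mx -mulmxA -SJ mulKmx // col_mxKu.
by case/mulmx1_unit.
Qed.

Lemma block_sym_sub (R : pzRingType) (n m : nat) (P N : 'M[R]_n)
    (u v p q : 'M[R]_(n, m)) :
  block_mx P N N P *m col_mx u (- v) = col_mx p (- q) ->
  (P + N) *m (u - v) = p - q.
Proof.
rewrite mul_block_col => /eq_col_mx [<- <-].
by rewrite mulmxDl !mulmxDr -!addrA; congr (_ + _); rewrite addrC addrAC addrC.
Qed.

Theorem theorem2 (R : realType) (n : nat) (A : 'M[R]_n)
    (b : 'I_n -> fuzzy_number R) (S_nonsingular : crisp_mx A \in unitmx) :
  (exists xl xu : 'I_n -> R -> R, strong_solution A b xl xu) <->
  {in `[0, 1], forall r, forall i : 'I_n,
    (invmx (pos_mx A + neg_mx A) *m (lower_vec b r - upper_vec b r)) i 0 <= 0}.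
Proof.
have BC_unit := unitmx_add_block_sym _ _ _ _ S_nonsingular.
(* This holds for every solution, so it serves both directions. *)
have solE xl xu r i : crisp_solution A b xl xu -> r \in `[0, 1] ->
    (invmx (pos_mx A + neg_mx A) *m (lower_vec b r - upper_vec b r)) i 0
    = xl i r - xu i r.
  by move=> sol r01; rewrite -(block_sym_sub _ _ _ _ _ _ _ _ _ (sol r r01)) mulKmx // !mxE.
split=> [[xl [xu [sol xlu]]] r r01 i|le0].
  by rewrite (solE xl xu) // subr_le0 xlu.
(* Solve at each r; the lower half of [y r] stands for [- xu], hence the sign in [xu]. *)
pose y r := invmx (crisp_mx A) *m col_mx (lower_vec b r) (- upper_vec b r).
pose xl i r := usubmx (y r) i 0; pose xu i r := - dsubmx (y r) i 0.
have sol : crisp_solution A b xl xu.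
  move=> r _.
  have -> : \col_i xl i r = usubmx (y r) by apply/colP => i; rewrite mxE.
  have -> : - (\col_i xu i r) = dsubmx (y r).
    by apply/colP => i; rewrite 2!mxE opprK.
  by rewrite vsubmxK mulKVmx.
by exists xl, xu; split=> // i r r01; rewrite -subr_le0 -(solE xl xu) // le0.
Qed.
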